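(* (In ZFC.) There exists an infinite monothetic countably compact topological group without nontrivial convergent sequences and without infinite suitable sets.
   Context: A topological group is monothetic if it has a dense cyclic subgroup. A space is countably compact if every countable open cover has a finite subcover. ''Without nontrivial convergent sequences'' means every convergent sequence is eventually constant. A suitable set in a topological group $H$ is a subset $S\subseteq H$ which is discrete (in the subspace topology), such that $S\cup\{1_H\}$ is closed in $H$ (where $1_H$ is the identity) and $S$ topologically generates $H$ (the subgroup generated by $S$ is dense in $H$). *)

(* Defs.v *)
From HB Require Import structures.
From mathcomp Require Import all_boot all_order all_algebra finmap.
From mathcomp Require Import all_classical all_reals topology.

Set Implicit Arguments.
Unset Strict Implicit.
Unset Printing Implicit Defensive.

Local Open Scope classical_set_scope.
Local Open Scope group_scope.

HB.mixin Record isTopologicalGroup G & Topological G & Group G := {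
  mulg_continuous : continuous (fun x : G * G => x.1 * x.2) ;
  invg_continuous : continuous (fun x : G => x^-1)
}.

(* No separation axiom is required; a topological group in which convergent
   sequences are eventually constant is Hausdorff anyway. *)
#[short(type="topologicalGroupType")]
HB.structure Definition TopologicalGroup :=
  {G of Topological G & Group G & isTopologicalGroup G}.

Definition eventually_constant (U : Type) (u : nat -> U) :=
  exists c : U, \forall n \near \oo, u n = c.

Section Topology.
Context {T : topologicalType}.

(* [cover_compact] with the index set [D] of the cover assumed countable. *)
Definition countably_compact (A : set T) :=
  forall (I : choiceType) (D : set I) (f : I -> set T),
  countable D -> (forall i, D i -> open (f i)) -> A `<=` cover D f ->
  finite_subset_cover D f A.

(* [set_type S] carries the subspace topology. *)
Definition discrete_subset (S : set T) := forall U : set (set_type S), open U.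

End Topology.

Definition no_nontrivial_convergent_seq (T : topologicalType) :=
  forall (u : nat -> T) (l : T), u @ \oo --> l -> eventually_constant u.

Definition generated_subgroup {G : groupType} (S : set G) : set G :=
  smallest (fun H : set G => group_closed [in H]) S.

Section TopologicalGroups.
Variable G : topologicalGroupType.

Definition monothetic := exists g : G, dense (generated_subgroup [set g]).

Definition suitable_set (S : set G) :=
  [/\ discrete_subset S, closed (S `|` [set 1]) &
      dense (generated_subgroup S)].

End TopologicalGroups.

(* Main.v *)
Require Import Defs.
From HB Require Import structures.
From mathcomp Require Import finmap all_boot all_order all_algebra.
From mathcomp Require Import all_classical all_reals topology normedtype sequences.
From mathcomp Require Import Rstruct freeg zify ring lra.

(** The group is a free abelian group of rank continuum.  Its basis is an
    inductive type of codes: the generator [Base], and limit codes, each of which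
    describes a sequence of integer combinations of simpler codes.  A free
    ultrafilter [limit_filter x] is attached to every limit code [x], and the
    group carries the coarsest topology that makes continuous all the
    homomorphisms [Phi] into the circle such that, for every limit code [x],
    [Phi x] is the limit of [Phi] along the sequence of [x] with respect to
    [limit_filter x].  Homomorphisms into the circle are represented by real
    functions on the codes, read modulo 1 through [nearZ]; they are called
    admissible.

    Every limit code is then the limit of its own sequence along an ultrafilter,
    and most of the theorem follows.  A sequence with infinitely many values has
    a subsequence that is written down by some limit code, so it has a cluster
    point: the group is countably compact.  In fact the subsequence is written
    down by two codes, so it has two different cluster points and the sequence
    does not converge, once the topology is known to be Hausdorff.  By induction
    on codes the closure of the subgroup generated by [Base] contains every
    code: the group is monothetic.  Finally, an infinite set [S] such that
    [S] together with 1 is closed contains one of two cluster points of an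
    injective sequence in [S], and hence [S] is not discrete.

    The heart of the proof is therefore [separation]: admissible characters
    separate points.  Let [a] be a nonzero vector.  Only the countably many
    codes reachable from [a] matter; on the other codes an admissible character
    is extended by well-founded recursion, the value at a code being the limit
    that admissibility prescribes ([extend]).  On the countable set [D] one has
    to find, for every limit code [x] in [D], a set in [limit_filter x] along
    which the value at [x] is approximated.  Two kinds of sequences suffice
    ([tame]).

    - If the sup-norms of a sequence grow very fast ([lacunary]), then changing
      the value of a character at a single coordinate, by at most the inverse of
      the norm of a vector, corrects the value at that vector.  Corrections for
      vectors of much larger norm are negligible for all vectors treated before.
    - If the norms are bounded and every term has a coordinate that does not
      occur earlier ([spreading]), then the terms are linearly independent, and
      a vector outside the span of finitely many vectors treated before can be
      corrected without changing anything at those vectors.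

    Both corrections fail for some terms, so terms have to be discarded, and the
    remaining ones must still form a set in the ultrafilter, although the
    ultrafilters are chosen before [a].  Here the natural numbers are cut into
    blocks, each much longer than all previous ones together.  The codes own
    almost disjoint sets of blocks ([trace]), and [limit_filter x] contains
    every set that misses only a small part of almost every block of [x].
    Within [D] almost all blocks have a single owner, and the terms are kept or
    rejected greedily.  The number of rejected terms in a block is bounded in
    terms of the number of earlier terms alone: by the exchange argument of
    linear algebra ([exchange], [spread_dropped]) for spreading sequences, and
    because each earlier vector excludes at most three scales ([steep_dropped])
    for lacunary ones. *)

Set Implicit Arguments.
Unset Strict Implicit.
Unset Printing Implicit Defensive.
Import Order.TTheory GRing.Theory Num.Theory.
Import numFieldNormedType.Exports.
Local Open Scope classical_set_scope.
Local Open Scope ring_scope.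

(** * Real-valued homomorphisms on a free abelian group *)

Section Evaluation.
Context {R : realType} {K : choiceType}.
Implicit Types (psi : K -> R) (a b : {freeg K / int}) (c : K).

Definition ev psi a : R := \sum_(c <- dom a) (coeff c a)%:~R * psi c.

Let lift psi : {freeg K / int} -> zmodule R := fglift (psi : K -> zmodule R).
HB.instance Definition _ psi := GRing.isAdditive.Build
  {freeg K / int} (zmodule R : zmodType) (lift psi) (lift_is_additive (psi : K -> zmodule R)).

Let ev_lift psi : ev psi =1 lift psi.
Proof.
move=> a; rewrite -{2}(freeg_sumE a) raddf_sum.
by apply: eq_bigr => c _; rewrite mulrzl; apply/esym; exact: (liftU (psi : K -> zmodule R)).
Qed.

Fact ev_is_additive psi : additive (ev psi).
Proof. by move=> a b; rewrite !ev_lift raddfB. Qed.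
HB.instance Definition _ psi := GRing.isAdditive.Build _ _ _ (ev_is_additive psi).

Lemma evU psi (z : int) c : ev psi << z *g c >> = z%:~R * psi c.
Proof. by rewrite ev_lift mulrzl; exact: (liftU (psi : K -> zmodule R)). Qed.

Lemma eq_ev psi psi' a : (forall c, c \in dom a -> psi c = psi' c) ->
  ev psi a = ev psi' a.
Proof. by move=> e; apply: eq_big_seq => c /e ->. Qed.

Lemma ev_sum (I : finType) (x : I -> R) (w : I -> K -> R) a :
  ev (fun c => \sum_i x i * w i c) a = \sum_i x i * ev (w i) a.
Proof.
under [RHS]eq_bigr do rewrite mulr_sumr.
rewrite exchange_big /=; apply: eq_bigr => c _; rewrite mulr_sumr.
by apply: eq_bigr => i _; rewrite mulrCA.
Qed.

Lemma evDl psi psi' a : ev (psi \+ psi') a = ev psi a + ev psi' a.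
Proof. by rewrite -big_split; apply: eq_bigr => c _; rewrite mulrDr. Qed.

Lemma evZl (r : R) psi a : ev (fun c => r * psi c) a = r * ev psi a.
Proof. by rewrite mulr_sumr; apply: eq_bigr => c _; rewrite mulrCA. Qed.

Lemma ev_delta c0 (r : R) a : ev (fun c => r *+ (c == c0)) a = (coeff c0 a)%:~R * r.
Proof.
rewrite /ev; have [c0a|c0a] := boolP (c0 \in dom a).
  rewrite (bigD1_seq c0) ?uniq_dom //= eqxx big1 ?addr0 // => c /negbTE ->.
  by rewrite mulr0.
rewrite coeff_outdom // mul0r big_seq big1 // => c ca.
by case: eqP => [cc0|_]; [rewrite -cc0 ca in c0a | rewrite mulr0].
Qed.

(** A sequence of vectors that admits a triangular dual family is linearly
    independent, so at most [size V] of its members can lie in the span of [V]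
    and the remaining ones.  Spans are expressed dually, by annihilators, so
    that no quotient space is needed. *)
Lemma exchange (m : nat) (f : 'I_m -> {freeg K / int}) (w : 'I_m -> K -> R)
    (V : seq {freeg K / int}) (S : seq 'I_m) :
  (forall i, ev (w i) (f i) != 0) ->
  (forall i j : 'I_m, (j < i)%N -> ev (w i) (f j) = 0) ->
  (forall psi i, (forall v, v \in V -> ev psi v = 0) ->
     (forall j, j \in S -> ev psi (f j) = 0) -> ev psi (f i) = 0) ->
  (m <= size V + size S)%N.
Proof.
move=> w_diag w_trig spanf; rewrite leqNgt; apply/negP => ltVS.
pose L := V ++ map f S.
pose M : 'M[R]_(m, size L) := \matrix_(i, j) ev (w i) (tnth (in_tuple L) j).
have kM : kermx M != 0.
  rewrite -mxrank_eq0 mxrank_ker subn_eq0 -ltnNge.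
  by apply: leq_ltn_trans (rank_leq_col _) _; rewrite size_cat size_map.
have [x xM x0] : exists2 x : 'rV[R]_m, x *m M = 0 & x != 0.
  have /rowV0Pn [x xk x0] := kM; exists x => //; exact/sub_kermxP.
pose psi c := \sum_i x 0 i * w i c.
have psiL v : v \in L -> ev psi v = 0.
  move=> /seq_tnthP [j ->]; rewrite ev_sum.
  transitivity ((x *m M) 0 j); last by rewrite xM mxE.
  by rewrite mxE; apply: eq_bigr => i _; rewrite mxE.
have psif i : ev psi (f i) = 0.
  apply: spanf => [v vV|j jS]; apply: psiL; rewrite mem_cat ?vV //.
  by rewrite map_f ?orbT.
suff x_eq0 n (i : 'I_m) : (i <= n)%N -> x 0 i = 0.
  by case/eqP: x0; apply/rowP => i; rewrite mxE; exact: (x_eq0 i).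
elim/ltn_ind: n i => n IH i le_in.
have := psif i; rewrite ev_sum (bigD1 i) //= big1 ?addr0 => [/eqP|j neq_ji].
  by rewrite mulf_eq0 (negbTE (w_diag i)) orbF => /eqP.
have [lt_ji|] := ltnP j i; first by rewrite (IH j) ?mul0r // (leq_trans lt_ji).
rewrite leq_eqVlt => /orP[/eqP e|/w_trig ->]; last by rewrite mulr0.
by move/eqP: neq_ji; case; exact/val_inj.
Qed.

End Evaluation.

(** * Reals modulo 1 *)

Section NearInteger.
Context {R : realType}.
Implicit Types (e r s : R).

Definition nearZ e r := exists z : int, `|r - z%:~R| < e.

Lemma nearZD e e' r s : nearZ e r -> nearZ e' s -> nearZ (e + e') (r + s).
Proof.
move=> [z rz] [y sy]; exists (z + y); rewrite rmorphD /= opprD addrACA.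
exact: le_lt_trans (ler_normD _ _) (ltrD rz sy).
Qed.

Lemma nearZN e r : nearZ e r -> nearZ e (- r).
Proof. by move=> [z rz]; exists (- z); rewrite rmorphN /= -opprD normrN. Qed.

Lemma nearZ_le e e' r : e <= e' -> nearZ e r -> nearZ e' r.
Proof. by move=> ee' [z rz]; exists z; exact: lt_le_trans rz ee'. Qed.

Lemma nearZ0 e : 0 < e -> nearZ e 0.
Proof. by exists 0; rewrite subr0 normr0. Qed.

(** The fractional parts live in a compact interval, and a cluster point of an
    ultrafilter is a limit. *)
Lemma ultra_limit_mod1 (p : set_system nat) (v : nat -> R) : UltraFilter p ->
  exists r, forall e, 0 < e -> p [set k | nearZ e (v k - r)].
Proof.
move=> pU.
pose u k := v k - (Num.floor (v k))%:~R.
have u01 k : u k \in `[0, 1].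
  rewrite in_itv /= /u subr_ge0 floor_le /= lerBlDl.
  by rewrite -(intrD _ (Num.floor (v k)) 1) ltW // floorD1_gt.
have cI : compact `[0 : R, 1]%classic by exact: segment_compact.
have [r [_ ur]] : `[0 : R, 1]%classic `&` cluster (u @ p) !=set0.
  by apply: cI; apply: (@filterS _ p _ setT) filterT => k _; exact: u01.
exists r => e e0.
have [|far] := in_ultra_setVsetC [set k | nearZ e (v k - r)] pU => //.
have [] := ur (u @` (~` [set k | nearZ e (v k - r)])) (ball r e).
- by apply: (@filterS _ p _ _ _ _ far) => k kfar; exists k.
- exact: nbhsx_ballx.
move=> _ [[k kfar <-]]; rewrite /ball /= distrC => rk; case: kfar.
by exists (Num.floor (v k)); rewrite addrAC.
Qed.

End NearInteger.

(** * Scales and blocks of natural numbers *)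

Section Blocks.
Local Open Scope nat_scope.

Definition last_below (h : nat -> nat) (k : nat) : nat :=
  \max_(n < k.+1 | h n <= k) n.

Lemma last_below_ge h n k : n <= h n -> h n <= k -> n <= last_below h k.
Proof.
move=> nh hk; have nk : n < k.+1 by rewrite ltnS (leq_trans nh).
exact: (@leq_bigmax_cond _ (fun n : 'I_k.+1 => h n <= k) _ (Ordinal nk)).
Qed.

Lemma last_belowP h k : {homo h : m n / m < n} -> h 0 <= k ->
  h (last_below h k) <= k < h (last_below h k).+1.
Proof.
move=> hh h0k; apply/andP; split.
  rewrite /last_below; apply: (big_ind (fun n => h n <= k)) => // m n hm hn.
  by rewrite /maxn; case: ifP.
rewrite ltnNge; apply/negP => hk.
have nh n : n <= h n by elim: n => // n IH; exact: leq_ltn_trans IH (hh _ _ _).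
by have := last_below_ge (nh _) hk; rewrite ltnn.
Qed.

Lemma last_below_unique h n k : {homo h : m n / m < n} ->
  h n <= k < h n.+1 -> last_below h k = n.
Proof.
move=> hh /andP[hnk khn].
have hle : {homo h : m n / m <= n} by move=> m m'; rewrite leq_eqVlt => /orP[/eqP-> //|/hh/ltnW].
have /andP[lk kl] := last_belowP hh (leq_trans (hle _ _ (leq0n n)) hnk).
apply/eqP; rewrite eqn_leq; apply/andP; split; rewrite leqNgt; apply/negP => lt.
  by have := leq_trans (leq_trans khn (hle _ _ lt)) lk; rewrite ltnn.
by have := leq_trans (leq_trans kl (hle _ _ lt)) hnk; rewrite ltnn.
Qed.

(** The bounds [2 ^ (j * j)] are chosen because their successive ratios tend to
    infinity and their inverses have a convergent sum. *)
Definition scale (N : nat) : nat := last_below (fun j => 2 ^ (j * j)) N.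

Let pow_homo : {homo (fun j => 2 ^ (j * j)) : m n / m < n}.
Proof. by move=> m n mn; rewrite ltn_exp2l // ltn_mul. Qed.

Lemma scaleP N : 0 < N -> 2 ^ (scale N * scale N) <= N < 2 ^ ((scale N).+1 * (scale N).+1).
Proof. exact: last_belowP pow_homo. Qed.

Lemma scale_pow j : scale (2 ^ (j * j)) = j.
Proof. by apply: last_below_unique pow_homo _; rewrite leqnn pow_homo. Qed.

Lemma scale_ge j N : 2 ^ (j * j) <= N -> j <= scale N.
Proof.
apply: (@last_below_ge (fun j => 2 ^ (j * j))).
apply: leq_trans (ltnW (ltn_expl j (ltnSn 1))) _.
by rewrite leq_exp2l //; case: j => // j; rewrite leq_pmulr.
Qed.

(** Block [n] starts at [block_start n] and has length [(n + 1) * slack n], where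
    [slack n] exceeds the number of all indices in earlier blocks by [n + 2],
    the number of constraints of [frame] below. *)
Fixpoint block_start (n : nat) : nat :=
  if n is m.+1 then block_start m + m.+1 * (block_start m + m.+2) else 0.

Definition slack (n : nat) : nat := block_start n + n.+2.

Definition block_of (k : nat) : nat := last_below block_start k.

Lemma block_startS n : block_start n.+1 = block_start n + n.+1 * slack n.
Proof. by []. Qed.

Let block_homo : {homo block_start : m n / m < n}.
Proof.
apply: homo_ltn => [|n]; first exact: ltn_trans.
by rewrite block_startS -[ltnLHS]addn0 ltn_add2l muln_gt0 /slack addnS.
Qed.

Lemma block_ofP k : block_start (block_of k) <= k < block_start (block_of k).+1.
Proof. exact: last_belowP block_homo _. Qed.

Lemma block_of_eq n k : block_start n <= k < block_start n.+1 -> block_of k = n.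
Proof. exact: last_below_unique block_homo. Qed.

Lemma block_start_ge n : n <= block_start n.
Proof. by elim: n => // n IH; exact: leq_ltn_trans IH (block_homo _). Qed.

Lemma block_of_mono j k : j <= k -> block_of j <= block_of k.
Proof.
move=> jk; have /andP[lj _] := block_ofP j.
exact: last_below_ge (block_start_ge _) (leq_trans lj jk).
Qed.

(** The sets that contain, of almost every block with number in [A], all but a
    number of elements that is small compared to the length of the block. *)
Definition block_filter (A : set nat) : set_system nat :=
  [set U | exists C n0, forall n, n0 <= n -> A n ->
    exists2 l : seq nat, size l <= C * slack n &
      forall k, block_of k = n -> k \in l \/ U k].

Lemma block_filter_cofinite (A U : set nat) m :
  (forall k, m <= k -> U k) -> block_filter A U.
Proof.
move=> mU; exists 0, m => n mn _; exists [::] => // k kn; right; apply: mU.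
apply: leq_trans mn _; rewrite -kn; apply: leq_trans (block_start_ge _) _.
by case/andP: (block_ofP k).
Qed.

(** Finitely many exceptional sets of size O(slack n) cannot cover block n, as
    its length is (n + 1) * slack n. *)
Lemma block_filter_proper (A : set nat) :
  (forall m, exists2 n, m <= n & A n) -> ProperFilter (block_filter A).
Proof.
move=> Ainf; split.
  move=> [C [n0 F0]]; have [n nge An] := Ainf (maxn C n0).
  move: nge; rewrite geq_max => /andP[Cn n0n].
  have [l sl ll] := F0 _ n0n An.
  have : size (iota (block_start n) (n.+1 * slack n)) <= size l.
    apply: uniq_leq_size (iota_uniq _ _) _ => k; rewrite mem_iota => kn.
    by case: (ll k) => //; apply: block_of_eq; rewrite block_startS.
  rewrite size_iota leqNgt => /negP; apply; apply: leq_ltn_trans sl _.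
  by rewrite ltn_pmul2r // /slack addnS.
split; first exact: (@block_filter_cofinite _ _ 0).
  move=> U V [C [n0 FU]] [C' [n0' FV]]; exists (C + C'), (maxn n0 n0') => n.
  rewrite geq_max => /andP[n0n n0'n] An.
  have [l sl lU] := FU _ n0n An; have [l' sl' lV] := FV _ n0'n An.
  exists (l ++ l') => [|k kn]; first by rewrite size_cat mulnDl leq_add.
  rewrite mem_cat; case: (lU k kn) => [->|Uk]; first by left.
  by case: (lV k kn) => [->|Vk]; [left; rewrite orbT|right].
move=> U V UV [C [n0 FU]]; exists C, n0 => n n0n An.
have [l sl lU] := FU _ n0n An; exists l => // k kn.
by case: (lU k kn) => [->|/UV]; [left|right].
Qed.

End Blocks.

(** * The sup-norm on a free abelian group *)

Section Norm.
Context {K : choiceType}.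
Implicit Types (a b : {freeg K / int}) (c : K).

Definition norm a : nat := \max_(c <- dom a) `|coeff c a|%N.

Lemma coeff_norm c a : (`|coeff c a|%N <= norm a)%N.
Proof.
have [ca|ca] := boolP (c \in dom a); last by rewrite coeff_outdom.
by rewrite /norm (big_rem c) //= leq_maxl.
Qed.

Lemma norm_attained a : (0 < norm a)%N -> exists2 c, c \in dom a & `|coeff c a|%N = norm a.
Proof.
rewrite /norm; elim: (dom a) => [|c s IH]; first by rewrite big_nil.
rewrite big_cons; case: (leqP `|coeff c a|%N (\max_(j <- s) `|coeff j a|%N)) => [le|lt] pos.
  by case: (IH pos) => c' c's <-; exists c' => //; rewrite inE c's orbT.
by exists c => //; rewrite mem_head.
Qed.

Lemma norm0 : norm 0 = 0%N.
Proof. by rewrite /norm dom0 big_nil. Qed.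

Lemma normU (z : int) c : norm << z *g c >> = `|z|%N.
Proof.
have [->|z0] := eqVneq z 0; first by rewrite freegU0 norm0.
by rewrite /norm domU // big_seq1 coeffU eqxx mulr1.
Qed.

Lemma normB_U1 a c c' : (`|coeff c' (a - << c >>)%R|%N <= norm a + 1)%N.
Proof.
rewrite coeffB coeffU mul1r; have := coeff_norm c' a.
by case: (c == c'); lia.
Qed.

Fixpoint box (C : nat) (s : seq K) : seq {freeg K / int} :=
  if s is c :: s' then
    [seq << (i%:Z - C%:Z) *g c >> + a | i <- iota 0 (C + C).+1, a <- box C s']
  else [:: 0].

(** The fixed list [box C s] witnesses that only finitely many vectors have
    norm at most [C] and support in [s]. *)
Lemma mem_box C s a : {subset dom a <= s} -> (norm a <= C)%N -> a \in box C s.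
Proof.
elim: s a => [|c s IH] a sub aC.
  rewrite inE -dom_eq0; case: (dom a) sub => // c s /(_ c).
  by rewrite inE eqxx => /(_ isT).
pose a' := a - << coeff c a *g c >>.
have a'E c' : coeff c' a' = if c' == c then 0 else coeff c' a.
  by rewrite coeffB coeffU eq_sym; case: eqP => [->|_]; rewrite ?mulr1 ?subrr ?mulr0 ?subr0.
have a's : {subset dom a' <= s}.
  move=> c'; rewrite mem_dom /= a'E; case: (c' =P c) => [_|nc a0]; first by rewrite eqxx.
  by have := sub c'; rewrite mem_dom a0 inE => /(_ isT); case: eqP.
have a'C : (norm a' <= C)%N.
  apply/bigmax_leqP_seq => c' _ _; rewrite a'E; case: eqP => // _.
  exact: leq_trans (coeff_norm _ _) aC.
apply/allpairsPdep; exists (absz (coeff c a + C%:Z)%R), a'; split.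
- rewrite mem_iota /=; have := coeff_norm c a; lia.
- exact: IH.
- have -> : ((absz (coeff c a + C%:Z)%R))%:Z - C%:Z = coeff c a.
    by have := coeff_norm c a; lia.
  by rewrite addrC subrK.
Qed.

End Norm.

(** * Codes, tame sequences and ultrafilters *)

(** A limit code with data [d] and [c] stands for a limit of the sequence of
    vectors whose k-th term has the coefficients [d k] at the codes [c k i].
    Inductive types provide the well-founded order for recursion, and countable
    branching keeps the number of codes down to the continuum.  The Boolean tag
    provides two codes for each sequence. *)
Inductive code : Type :=
  | Base
  | Limit of bool & (nat -> seq int) & (nat -> nat -> code).

HB.instance Definition _ := gen_eqMixin code.
HB.instance Definition _ := gen_choiceMixin code.

Local Notation vec := {freeg code / int}.

Section Sequences.
Implicit Types (f : nat -> vec) (x y : code).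

Definition written (d : nat -> seq int) (c : nat -> nat -> code) (k : nat) : vec :=
  \sum_(i < size (d k)) << (d k)`_i *g c k i >>.

(** The k-th term is spelled out over its own support. *)
Lemma written_surj f : exists d c, written d c = f.
Proof.
exists (fun k => [seq coeff c (f k) | c <- dom (f k)]).
exists (fun k i => nth Base (dom (f k)) i).
apply/funext => k; rewrite /written size_map -[RHS]freeg_sumE (big_nth Base) big_mkord.
by apply: eq_bigr => i _; rewrite (nth_map Base).
Qed.

(** The gap of two scales leaves a factor that tends to infinity between the
    norms of two consecutive terms. *)
Definition lacunary f := forall k, (0 < norm (f k))%N /\
  forall j, (j < k)%N -> (scale (norm (f j)) + 2 <= scale (norm (f k)))%N.

Definition spreading f := (exists C, forall k, (norm (f k) <= C)%N) /\
  forall k, exists c, coeff c (f k) != 0 /\ forall j, (j < k)%N -> coeff c (f j) = 0.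

Definition tame f := lacunary f \/ spreading f.

(** A default sequence for the codes whose written sequence is not tame, so that
    every code carries a tame sequence. *)
Definition base_powers (k : nat) : vec := << (2 ^ (k.*2 * k.*2))%:Z *g Base >>.

Lemma base_powers_tame : tame base_powers.
Proof.
left => k; rewrite !normU /= expn_gt0; split=> // j jk.
by rewrite normU /= !scale_pow; lia.
Qed.

Lemma lacunary_scale f k : lacunary f -> (k <= scale (norm (f k)))%N.
Proof.
move=> fl; elim: k => // k IH; have [_ /(_ k (ltnSn k))] := fl k.+1; lia.
Qed.

Lemma tame_inj f : tame f -> injective f.
Proof.
move=> ft; suff neq j k : (j < k)%N -> f j <> f k.
  move=> j k e; case: (ltngtP j k) => // [/neq|/neq]; last move/nesym; by move/(_ e).
move=> jk e; case: ft => [/(_ k)[_ /(_ j jk)]|[_ /(_ k) [c [ck /(_ j jk)]]]].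
  rewrite e; lia.
by rewrite e; apply/eqP.
Qed.

Lemma select (T : eqType) (P : seq T -> T -> Prop) :
  (forall l, exists z, P l z) ->
  exists s : nat -> T, forall k, P [seq s j | j <- iota 0 k] (s k).
Proof.
move=> Pex; pose nx l := sval (cid (Pex l)).
pose L := fix L k := if k is k'.+1 then rcons (L k') (nx (L k')) else [::].
have LE k : L k = [seq nx (L j) | j <- iota 0 k].
  by elim: k => // k IH; rewrite -addn1 iotaD map_cat -IH addn1 /= cats1 add0n.
by exists (fun k => nx (L k)) => k; rewrite -LE; exact: svalP (cid (Pex (L k))).
Qed.

(** Vectors of bounded norm and bounded support form a finite set, so a
    sequence with infinitely many values either has unbounded norms or has
    supports reaching outside every finite set. *)
Lemma tame_subsequence f : (forall l : seq vec, exists k, f k \notin l) ->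
  exists s : nat -> nat, tame (f \o s).
Proof.
move=> finf; have [[C fC]|unb] := pselect (exists C, forall k, (norm (f k) <= C)%N).
  have Pex (l : seq nat) : exists k, exists c, c \in dom (f k) /\ forall j, j \in l -> c \notin dom (f j).
    pose S := flatten [seq dom (f j) | j <- l].
    have [k /negP kb] := finf (box C S); exists k; apply: contrapT => nc; apply: kb.
    apply: mem_box (fC k) => c ck; apply: contrapT => /negP cS; apply: nc.
    exists c; split=> // j jl; apply: contra cS => cj.
    by apply/flatten_mapP; exists j.
  have [s sP] := select Pex; exists s; right; split; first by exists C => k; exact: fC.
  move=> k; have [c [ck cj]] := sP k; exists c; rewrite -mem_dom; split=> // j jk.
  by apply: coeff_outdom; apply: cj; rewrite map_f // mem_iota.
have Pex (l : seq nat) : exists k, (0 < norm (f k))%N /\ forall j, j \in l -> (scale (norm (f j)) + 2 <= scale (norm (f k)))%N.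
  pose m := \max_(j <- l) (scale (norm (f j)) + 2).
  have [k kb] : exists k, (2 ^ (m * m) < norm (f k))%N.
    apply: contrapT => nk; apply: unb; exists (2 ^ (m * m))%N => k.
    by rewrite leqNgt; apply/negP => kb; apply: nk; exists k.
  exists k; split=> [|j jl]; first exact: leq_ltn_trans kb.
  apply: leq_trans (scale_ge (ltnW kb)); rewrite /m (big_rem j) //=; exact: leq_maxl.
have [s sP] := select Pex; exists s; left => k; have [k0 kl] := sP k; split=> // j jk.
by apply: kl; rewrite map_f // mem_iota.
Qed.

Definition seq_of x : nat -> vec :=
  if x is Limit _ d c then
    if `[< tame (written d c) >] then written d c else base_powers
  else base_powers.

Lemma seq_of_tame x : tame (seq_of x).
Proof.
case: x => [|b d c] /=; first exact: base_powers_tame.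
by case: asboolP => // _; exact: base_powers_tame.
Qed.

Lemma tame_seq_of f : tame f ->
  exists x y, [/\ x <> Base, y <> Base, x <> y, seq_of x = f & seq_of y = f].
Proof.
move=> ft; have [d [c dcf]] := written_surj f.
by exists (Limit true d c), (Limit false d c); split=> //=; rewrite dcf asboolT.
Qed.

Lemma dom_seq_of x k c0 : c0 \in dom (seq_of x k) ->
  c0 = Base \/ exists b d c i, x = Limit b d c /\ c0 = c k i.
Proof.
have bp : c0 \in dom (base_powers k) -> c0 = Base.
  by rewrite /base_powers domU ?inE => [/eqP//|]; rewrite eqz_nat expn_eq0.
case: x => [/bp|b d c] /=; first by left.
case: asboolP => [_|_ /bp]; last by left.
rewrite /written => /dom_sum_subset/flatten_mapP[i _].
have [->|di] := eqVneq (d k)`_i 0; first by rewrite freegU0 dom0.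
by rewrite domU // inE => /eqP ->; right; exists b, d, c, i.
Qed.

(** No code is one of its own immediate subterms. *)
Lemma notin_dom_seq_of x k : x <> Base -> x \notin dom (seq_of x k).
Proof.
move=> xB; apply/negP => /dom_seq_of [//|[b [d [c [i [-> {x xB}]]]]]].
suff neq x b' d' c' k' i' : x = Limit b' d' c' -> x <> c' k' i' by exact: neq (erefl _).
elim: x b' d' c' k' i' => // b0 d0 c0 IH b' d' c' k' i' [_ _ <-] e.
by apply: (IH k' i' b0 d0 c0 k' i'); rewrite -e.
Qed.

End Sequences.

(** * Almost disjoint sets of blocks *)

Section Traces.
Implicit Types (x y : code) (p : seq (nat * nat)).

(** The label function presents a code as a tree: the path entry [(k, i.+1)]
    leads to the subterm [c k i], and the entry [(k, 0)] reads off the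
    coefficients [d k].  Hence there are at most continuum many codes, and they
    can index an almost disjoint family. *)
Fixpoint label x p : option (seq int) :=
  match x, p with
  | Base, _ => None
  | Limit b d c, [::] => Some [:: Posz b]
  | Limit b d c, (k, 0) :: _ => Some (d k)
  | Limit b d c, (k, i.+1) :: q => label (c k i) q
  end.

Lemma label_inj : injective label.
Proof.
elim=> [|b d c IH] [|b' d' c'] // e; have lE p := congr1 (@^~ p) e.
- by have := lE [::].
- by have := lE [::].
have -> : b = b' by have [] := lE [::]; case: b b' {IH e lE} => [] [].
have -> : d = d' by apply/funext => k; have [] := lE [:: (k, 0)].
congr Limit; apply/funext => k; apply/funext => i; apply: IH.
by apply/funext => q; exact: lE ((k, i.+1) :: q).
Qed.

Definition label_prefix x m : seq (option (seq int)) :=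
  mkseq (fun i => label x (odflt [::] (unpickle i))) m.

(** The initial segments of the labelling, viewed as a point of the Baire
    space: two different branches share only finitely many segments. *)
Definition trace x : set nat := [set n | exists m, n = pickle (label_prefix x m)].

Lemma trace_infinite x m : exists2 n, (m <= n)%N & trace x n.
Proof.
apply: contrapT => nP.
have lt i : (pickle (label_prefix x i) < m)%N.
  by rewrite ltnNge; apply/negP => le; apply: nP; eexists; first exact: le; exists i.
pose g (i : 'I_m.+1) : 'I_m := Ordinal (lt i).
have : (#|'I_m.+1| <= #|'I_m|)%N.
  apply: (@leq_card _ _ g) => i j [] /(pcan_inj pickleK) /(congr1 size).
  by rewrite !size_mkseq => e; exact: val_inj.
by rewrite !card_ord ltnn.
Qed.

Lemma trace_almost_disjoint x y : x <> y ->
  exists n0, forall n, (n0 <= n)%N -> trace x n -> ~ trace y n.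
Proof.
move=> xy; have [p lp] : exists p, label x p <> label y p.
  by apply: contrapT => ne; apply/xy/label_inj/funext => p; apply: contrapT => lp; apply: ne; exists p.
pose i := pickle p; exists (\max_(m < i.+1) (pickle (label_prefix x m))).+1 => n.
move=> n0n [m nx] [m' ny]; have := pcan_inj pickleK (etrans (esym nx) ny) => e.
have mm' : m = m' by have /(congr1 size) := e; rewrite !size_mkseq.
have [mi|im] := ltnP m i.+1.
  move: n0n; rewrite nx ltnNge => /negP; apply.
  exact: (@leq_bigmax _ (fun m : 'I_i.+1 => pickle (label_prefix x m)) (Ordinal mi)).
by apply: lp; have /(congr1 (fun s => nth None s i)) := e; rewrite !nth_mkseq -?mm' // pickleK.
Qed.

Lemma limit_filter_exists x :
  exists F : set_system nat, UltraFilter F /\ block_filter (trace x) `<=` F.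
Proof.
have := block_filter_proper (trace_infinite x); exact: ultraFilterLemma.
Qed.

Definition limit_filter x : set_system nat := sval (cid (limit_filter_exists x)).

Lemma limit_filter_ultra x : UltraFilter (limit_filter x).
Proof. by have [] := svalP (cid (limit_filter_exists x)). Qed.

Lemma limit_filter_block x : block_filter (trace x) `<=` limit_filter x.
Proof. by have [] := svalP (cid (limit_filter_exists x)). Qed.

Lemma limit_filter_cofinite x m U : (forall k, (m <= k)%N -> U k) -> limit_filter x U.
Proof. by move=> mU; apply: limit_filter_block; exact: block_filter_cofinite mU. Qed.

End Traces.

(** * Limits of sequences with geometric increments *)

Section GeometricLimit.
Context {R : realType}.

(** The sequence [w n - g n] is nondecreasing and bounded, where [g n] bounds the
    sum of the increments from [n] on. *)
Lemma geometric_limit (w : nat -> R) (C : R) (J : nat) :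
  (forall j, (J <= j)%N -> `|w j.+1 - w j| <= C / 2 ^+ j) ->
  cvgn w /\ `|limn w - w J| <= 2 * C / 2 ^+ J.
Proof.
move=> wC; pose g n : R := 2 * C / 2 ^+ n.
have gS n : g n = g n.+1 + C / 2 ^+ n.
  by rewrite /g exprS; field; rewrite expf_neq0 ?pnatr_eq0.
have wg n : `|w (n + J)%N - w J| <= g J - g (n + J)%N.
  elim: n => [|n IH]; first by rewrite !subrr normr0.
  have := wC _ (leq_addl n J); have := gS (n + J)%N; rewrite addSn => e h.
  have -> : w (n + J).+1 - w J = (w (n + J).+1 - w (n + J)%N) + (w (n + J)%N - w J) by ring.
  by apply: le_trans (ler_normD _ _) _; lra.
have C0 : 0 <= C.
  have := le_trans (normr_ge0 _) (wC J (leqnn J)).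
  by rewrite pmulr_lge0 // invr_gt0 exprn_gt0.
have g0 n : 0 <= g n by rewrite mulr_ge0 ?invr_ge0 ?exprn_ge0 ?mulr_ge0.
have gcvg : g @ \oo --> (0 : R).
  have -> : g = geometric (2 * C) (1 / 2).
    by apply/funext => n; rewrite /geometric /g /= expr_div_n expr1n mul1r.
  by apply: cvg_geometric; rewrite ger0_norm; lra.
pose u n := w (n + J)%N - g (n + J)%N.
have ucvg : cvgn u.
  apply: nondecreasing_is_cvgn.
    apply/nondecreasing_seqP => n; rewrite /u addSn.
    have := wC _ (leq_addl n J); have := gS (n + J)%N; rewrite ler_norml => e /andP[h1 h2].
    by lra.
  exists (w J + g J) => _ [n _ <-]; have := wg n; rewrite /u ler_norml => /andP[h1 h2].
  by have := g0 (n + J)%N; lra.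
have wcvg : cvgn w.
  have wu : [sequence w (n + J)%N]_n = u \+ [sequence g (n + J)%N]_n.
    by apply/funext => n; rewrite /u /= subrK.
  apply/cvg_ex; exists (limn u + 0); rewrite -(cvg_shiftn J) wu.
  by apply: cvgD ucvg _; rewrite cvg_shiftn.
split=> //.
apply: (ler_cvg_to (cvg_norm (cvgB wcvg (cvg_cst (w J)))) (cvg_cst (2 * C / 2 ^+ J))).
near=> n; have Jn : (J <= n)%N by near: n; exists J.
have := wg (n - J)%N; rewrite subnK // => h; apply: le_trans h _.
by rewrite lerBlDr lerDl.
Unshelve. all: by end_near.
Qed.

End GeometricLimit.

(** * Admissible characters separate points *)

Section Admissible.
Context {R : realType}.

Definition admissible (Phi : code -> R) : Prop := forall x, x <> Base ->
  forall e, 0 < e ->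
  limit_filter x [set k | nearZ e (ev Phi (seq_of x k) - Phi x)].

Definition ultra_limit x (v : nat -> R) : R :=
  xget 0 [set r | forall e, 0 < e -> limit_filter x [set k | nearZ e (v k - r)]].

Lemma ultra_limitP x v e : 0 < e ->
  limit_filter x [set k | nearZ e (v k - ultra_limit x v)].
Proof.
have [r rP] := ultra_limit_mod1 v (limit_filter_ultra x).
pose P := [set r | forall e, 0 < e -> limit_filter x [set k | nearZ e (v k - r)]].
by apply: (xgetPex 0 (P := P)); exists r.
Qed.

End Admissible.

(** In this section a nonzero vector [a] and a countable set of codes, listed by
    [D] and closed under passing to the supports of sequences, are fixed. *)
Section Separation.
Context {R : realType}.
Implicit Types (psi Phi : code -> R) (k j n : nat) (c : code).

Variables (a : vec) (D : nat -> code).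
Hypothesis D_a : forall c, c \in dom a -> range D c.
Hypothesis D_closed : forall i k c, c \in dom (seq_of (D i) k) -> range D c.

Definition owner_index n : nat :=
  find (fun i => `[< trace (D i) n /\ D i <> Base >]) (iota 0 n.+1).

Definition owner k : code :=
  let i := owner_index (block_of k) in if (i <= block_of k)%N then D i else Base.

Lemma ownerP k : owner k <> Base -> exists2 i, (i <= block_of k)%N & owner k = D i.
Proof. by rewrite /owner; case: ifP => // le _; eexists; first exact: le. Qed.

(** The owner is the first candidate.  Each of the finitely many candidates
    listed before [D i] that differ from [D i] shares only finitely many blocks
    with it. *)
Lemma owner_eventually i : D i <> Base -> exists n0, forall k,
  (n0 <= block_of k)%N -> trace (D i) (block_of k) -> owner k = D i.
Proof.
move=> iB.
have sep i' : exists n0, D i' <> D i ->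
    forall n, (n0 <= n)%N -> trace (D i) n -> ~ trace (D i') n.
  have [e|ne] := pselect (D i' = D i); first by exists 0%N.
  by have [n0 n0P] := trace_almost_disjoint (nesym ne); exists n0.
pose n0 i' := sval (cid (sep i')).
exists (i + \max_(i' < i.+1) n0 i')%N => k nk tr.
pose P i := `[< trace (D i) (block_of k) /\ D i <> Base >].
have ik : (i <= block_of k)%N by lia.
have Pi : has P (iota 0 (block_of k).+1).
  by apply/hasP; exists i; rewrite ?mem_iota //; exact/asboolP.
have fk : (owner_index (block_of k) < (block_of k).+1)%N.
  by rewrite -[ltnRHS](size_iota 0) -has_find.
have := nth_find 0%N Pi; rewrite -/(owner_index _) nth_iota // add0n => /asboolP[tr' _].
have le : (owner_index (block_of k) <= i)%N.
  rewrite leqNgt; apply/negP => lt; have := before_find 0%N lt.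
  by rewrite nth_iota ?ltnS // add0n; move/asboolP; apply.
rewrite /owner -ltnS fk; apply: contrapT => ne.
apply: (svalP (cid (sep (owner_index (block_of k)))) ne _ _ tr tr').
rewrite -/(n0 _); apply: leq_trans nk; apply: leq_trans (leq_addl _ _).
exact: (@leq_bigmax _ (fun j : 'I_i.+1 => n0 j) (Ordinal (le : (_ < i.+1)%N))).
Qed.

(** The index [k] concerns a single code, the owner of its block; admissibility
    asks that a character be almost integral at [item k] for most of those [k]. *)
Definition item k : vec := seq_of (owner k) k - << owner k >>.

(** Values that exact corrections must leave alone from stage [k] on: the one at
    [a], which is to stay away from the integers, and those at more and more
    codes of [D], which have to converge. *)
Definition frame k : seq vec := a :: [seq << D i >> | i <- iota 0 (block_of k).+1].

Definition steep k := `[< lacunary (seq_of (owner k)) >].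

Definition level k := scale (norm (seq_of (owner k) k)).

(** Vectors of lower level are ignored, so that all the corrections together
    move the value at [a] by at most 1/4. *)
Definition first_level := (8 * norm a)%N.

(** [l] lists the indices kept so far.  A steep item must be at least two levels
    away from the steep items kept so far, a spreading one must lie outside the
    span of the frame and of all the items kept so far. *)
Definition fits (l : seq nat) k : Prop :=
  owner k <> Base /\
  if steep k then
    (first_level <= level k)%N /\
    forall j, j \in l -> steep j -> (level j + 2 <= level k \/ level k + 2 <= level j)%N
  else
    exists2 psi : code -> R,
      (forall v, v \in frame k ++ map item l -> ev psi v = 0) & ev psi (item k) != 0.

Fixpoint kept_before k : seq nat :=
  if k is k'.+1 then
    if `[< fits (kept_before k') k' >] then k' :: kept_before k' else kept_before k'
  else [::].

Definition kept k := `[< fits (kept_before k) k >].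

Lemma mem_kept_before j k : (j \in kept_before k) = (j < k)%N && kept j.
Proof.
elim: k => //= k IH; rewrite -/(kept k) ltnS leq_eqVlt.
have [e|jk] /= := eqVneq j k.
  by subst j; case kk: (kept k); rewrite ?mem_head // IH ltnn.
by case: (kept k); rewrite ?inE ?(negbTE jk) IH.
Qed.

Lemma size_kept_before k : (size (kept_before k) <= k)%N.
Proof. by elim: k => //= k IH; case: ifP => // _; exact: leqW. Qed.

Lemma frameP v k :
  v \in frame k <-> v = a \/ exists2 i, (i <= block_of k)%N & v = << D i >>.
Proof.
rewrite /frame; set s := map _ _; rewrite inE; split.
  case/orP => [/eqP|]; [by left | rewrite /s => /mapP[i]].
  by rewrite mem_iota => ik ->; right; exists i.
move=> [->|[i ik ->]]; rewrite ?eqxx //; apply/orP; right.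
by apply/mapP; exists i; rewrite ?mem_iota.
Qed.

Definition settled k : seq vec := frame k ++ map item (kept_before k).

Lemma item_settled k j : kept k -> (k < j)%N -> item k \in settled j.
Proof. by move=> kk kj; rewrite mem_cat map_f ?orbT // mem_kept_before kj. Qed.

Lemma dom_item k c : owner k <> Base -> c \in dom (item k) -> range D c.
Proof.
move=> /ownerP[i _ oi] /domB; rewrite oi mem_cat => /orP[/D_closed//|].
by rewrite domU1 inE => /eqP ->; exists i.
Qed.

(** A functional that vanishes on the settled vectors but not on the item can be
    rescaled. *)
Lemma spread_correction k (phi : code -> R) : exists psi,
  (forall v, v \in settled k -> ev psi v = 0) /\
  (kept k -> ~~ steep k -> ev (phi \+ psi) (item k) = 0).
Proof.
have [/andP[kk ks]|no] := boolP (kept k && ~~ steep k); last first.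
  exists (fun=> 0); split=> [v _|kk ks]; last by rewrite kk ks in no.
  by rewrite /ev big1 // => c _; rewrite mulr0.
have /asboolP[_] := kk; rewrite (negbTE ks) => -[psi psi0 psik].
exists (fun c => - (ev phi (item k) / ev psi (item k)) * psi c).
split=> [v /psi0 e|_ _]; first by rewrite evZl e mulr0.
by rewrite evDl evZl mulNr mulfVK ?subrr.
Qed.

Lemma kept_steep_level k j : kept k -> steep k -> kept j -> steep j ->
  [\/ k = j, level k + 2 <= level j | level j + 2 <= level k]%N.
Proof.
wlog kj : k j / (k < j)%N => [H kk ks jk js|kk ks /asboolP[_] + js].
  case: (ltngtP k j) => [?|gt|]; [exact: H | | by constructor 1].
  by case: (H j k gt jk js kk ks) => *; [constructor 1|constructor 3|constructor 2].
rewrite js => -[_ /(_ k)]; rewrite mem_kept_before kj kk => /(_ isT ks)[]; by [apply: Or32|apply: Or33].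
Qed.

(** At most one kept steep item has level [j].  Its largest coefficient is at
    least [2 ^ (j * j)], so the value at the item becomes an integer after a
    change of at most the inverse of that number at a single code. *)
Lemma steep_correction j (phi : code -> R) : exists psi,
  [/\ forall v (C : nat), (forall c, (`|coeff c v|%N <= C)%N) ->
        `|ev psi v| <= C%:R / 2 ^+ (j * j),
      forall k, kept k -> steep k -> level k = j ->
        exists z : int, ev (phi \+ psi) (item k) = z%:~R &
      (forall k, kept k -> steep k -> level k <> j) -> forall v, ev psi v = 0].
Proof.
have [[k [kk ks kj]]|no] := pselect (exists k, [/\ kept k, steep k & level k = j]); last first.
  have ev0 v : ev (fun=> 0 : R) v = 0 by rewrite /ev big1 // => c _; rewrite mulr0.
  exists (fun=> 0); split=> [v C _|k kk ks kj|//].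
    by rewrite ev0 normr0 divr_ge0 ?exprn_ge0.
  by case: no; exists k.
have /asboolP[oB _] := kk; have /asboolP/(_ k)[Npos _] := ks.
have [c cd cN] := norm_attained Npos.
have cK : coeff c (item k) = coeff c (seq_of (owner k) k).
  rewrite coeffB coeffU mul1r; case: eqP => [oc|_]; last by rewrite subr0.
  by have := notin_dom_seq_of k oB; rewrite {1}oc cd.
have Mpow : 2 ^+ (j * j) <= `|(coeff c (item k))%:~R : R|.
  rewrite -intr_norm cK -natr_absz cN -natrX ler_nat -kj.
  by case/andP: (scaleP Npos).
have M0 : (coeff c (item k))%:~R != 0 :> R.
  by rewrite -normr_gt0; apply: lt_le_trans Mpow; rewrite exprn_gt0.
pose z := Num.floor (ev phi (item k)).
pose del : R := (z%:~R - ev phi (item k)) / (coeff c (item k))%:~R.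
have del_small : `|del| <= (2 ^+ (j * j))^-1.
  rewrite normrM normfV -[leRHS]mul1r; apply: ler_pM; rewrite ?invr_ge0 //.
    have := floor_itv (ev phi (item k)); rewrite -/z intrD => /andP[h1 h2].
    by rewrite ler_norml; lra.
  by rewrite lef_pV2 // posrE ?normr_gt0 // exprn_gt0.
exists (fun c' => del *+ (c' == c)); split=> [v C vC|k' kk' ks' kj'|/(_ k)]; last by case.
- rewrite ev_delta normrM; apply: ler_pM => //.
  by rewrite -intr_norm -natr_absz ler_nat.
- have -> : k' = k by have [] := kept_steep_level kk' ks' kk ks => //; rewrite kj kj'; lia.
  by exists z; rewrite evDl ev_delta /del mulrC divfK // addrC subrK.
Qed.

Definition spread_fix k (phi : code -> R) := sval (cid (spread_correction k phi)).

Definition steep_fix j (phi : code -> R) := sval (cid (steep_correction j phi)).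

Definition leading := head Base (dom a).

(** Stage [j] first corrects the spreading item with index [j] and then the steep
    item of level [j].  A steep item has an index at most its level, so whatever
    is corrected before stage [j] has an index below [j] and is settled. *)
Fixpoint approx j : code -> R :=
  if j is j'.+1 then
    let phi := approx j' \+ spread_fix j' (approx j') in phi \+ steep_fix j' phi
  else fun c => (2 * (coeff leading a)%:~R)^-1 *+ (c == leading).

Hypothesis a_neq0 : a != 0.

Lemma approx0 : ev (approx 0) a = 1 / 2.
Proof.
have c0 : (coeff leading a)%:~R != 0 :> R.
  rewrite intr_eq0 -mem_dom /leading; move: a_neq0; rewrite -dom_eq0.
  by case: (dom a) => // c s _; exact: mem_head.
by rewrite ev_delta invfM mulrCA mulfV // mulr1 mul1r.
Qed.

Lemma approx_settled j v : v \in settled j ->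
  ev (approx j.+1) v = ev (approx j) v +
    ev (steep_fix j (approx j \+ spread_fix j (approx j))) v.
Proof.
move=> vj; rewrite /= 2!evDl; have [-> //] := svalP (cid (spread_correction j (approx j))).
by rewrite addr0.
Qed.

Lemma approx_step j v (C : nat) : v \in settled j ->
  (forall c, (`|coeff c v|%N <= C)%N) ->
  `|ev (approx j.+1) v - ev (approx j) v| <= C%:R / 2 ^+ (j * j).
Proof.
move=> /approx_settled -> vC; rewrite addrC addKr.
by have [+ _ _] := svalP (cid (steep_correction j (approx j \+ spread_fix j (approx j)))); exact.
Qed.

Lemma approx_still j v : v \in settled j ->
  (forall k, kept k -> steep k -> level k <> j) -> ev (approx j.+1) v = ev (approx j) v.
Proof.
move=> /approx_settled -> no.
have [_ _] := svalP (cid (steep_correction j (approx j \+ spread_fix j (approx j)))).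
by move=> /(_ no) e; rewrite [X in _ + X]e addr0.
Qed.

Lemma ler_pow_square (C : R) j : 0 <= C -> C / 2 ^+ (j * j) <= C / 2 ^+ j.
Proof.
move=> C0; rewrite ler_wpM2l // lef_pV2 ?posrE ?exprn_gt0 // ler_eXn2l ?ltr1n //.
by case: j => // j; rewrite leq_pmulr.
Qed.

(** This is meaningful for [c] in the range of [D] only. *)
Definition ultimate c : R := limn (approx^~ c).

Lemma approx_cvg c : range D c -> approx^~ c @ \oo --> ultimate c.
Proof.
move=> [i _ <-]; have evU1 j : approx j (D i) = ev (approx j) << D i >>.
  by rewrite evU mul1r.
have [|//] := @geometric_limit R (approx^~ (D i)) 1 (block_start i).
move=> j ij; rewrite !evU1; apply: le_trans (ler_pow_square _ _) => //.
apply: (@approx_step _ _ 1); last by move=> c'; rewrite coeffU mul1r; case: (_ == _).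
rewrite mem_cat; apply/orP; left; apply/frameP; right; exists i => //.
by apply: leq_trans (block_of_mono ij); apply: last_below_ge; rewrite ?block_start_ge.
Qed.

Lemma ultimate_near v (C : R) J : (forall c, c \in dom v -> range D c) ->
  (forall j, (J <= j)%N -> `|ev (approx j.+1) v - ev (approx j) v| <= C / 2 ^+ j) ->
  `|ev ultimate v - ev (approx J) v| <= 2 * C / 2 ^+ J.
Proof.
move=> vD /geometric_limit[_]; suff -> : limn (fun j => ev (approx j) v) = ev ultimate v by [].
apply: cvg_lim => //; rewrite /ev big_seq.
have -> : (fun j => \sum_(c <- dom v) (coeff c v)%:~R * approx j c) =
    (fun j => \sum_(c <- dom v | c \in dom v) (coeff c v)%:~R * approx j c).
  by apply/funext => j; rewrite big_seq.
apply: (cvg_big (op := +%R)) => [|c /vD /approx_cvg cc]; first exact: add_continuous.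
exact: cvgM (cvg_cst _) cc.
Qed.

Lemma ultimate_a : `|ev ultimate a - 1 / 2| <= 1 / 4.
Proof.
have aj j : a \in settled j by rewrite mem_cat mem_head.
have -> : 1 / 2 = ev (approx first_level) a.
  rewrite -approx0; suff e j : (j <= first_level)%N -> ev (approx j) a = ev (approx 0) a by rewrite e.
  elim: j => [//|j IH jl]; transitivity (ev (approx j) a); last exact/IH/ltnW.
  apply: approx_still (aj j) _ => k kk ks; have /asboolP[_] := kk.
  by rewrite ks => -[le _] e; move: jl; rewrite -e ltnNge le.
apply: le_trans (@ultimate_near a (norm a)%:R first_level D_a _) _ => [j _|].
  apply: le_trans (approx_step _ (coeff_norm^~ a)) (ler_pow_square _ _) => //.
rewrite ler_pdivrMr ?exprn_gt0 //.
have : (first_level < 2 ^ first_level)%N by exact: ltn_expl.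
rewrite -(ltr_nat R) natrX [X in X%:R]/first_level natrM.
by move: (2 ^+ first_level) ((norm a)%:R) => X N; lra.
Qed.

Lemma spread_item k (C : nat) : kept k -> ~~ steep k ->
  (norm (seq_of (owner k) k) <= C)%N ->
  `|ev ultimate (item k)| <= 2 * C.+1%:R / 2 ^+ k.
Proof.
move=> kk ks NC; have /asboolP[oB _] := kk.
have iC c : (`|coeff c (item k)|%N <= C.+1)%N.
  by apply: leq_trans (normB_U1 _ _ _) _; rewrite addn1.
have first : `|ev (approx k.+1) (item k)| <= C.+1%:R / 2 ^+ k.
  apply: le_trans (ler_pow_square _ _) => //; rewrite /= evDl.
  have [_ e] := svalP (cid (spread_correction k (approx k))).
  rewrite (e kk ks) add0r.
  by have [+ _ _] := svalP (cid (steep_correction k (approx k \+ spread_fix k (approx k)))); exact.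
have next := @ultimate_near (item k) C.+1%:R k.+1 (fun c => dom_item oB) _.
have {}next : `|ev ultimate (item k) - ev (approx k.+1) (item k)| <= C.+1%:R / 2 ^+ k.
  apply: le_trans (next _) _ => [j kj|]; last first.
    by rewrite exprS le_eqVlt; apply/orP; left; apply/eqP; field; rewrite expf_neq0 ?pnatr_eq0.
  apply: le_trans (approx_step _ iC) (ler_pow_square _ _) => //; exact: item_settled.
rewrite -[ev ultimate _](subrK (ev (approx k.+1) (item k))).
apply: le_trans (ler_normD _ _) _; lra.
Qed.

(** After stage [level k] only steep corrections of levels at least [level k + 2]
    affect the item, since equal and adjacent levels are excluded. *)
Lemma steep_item k : kept k -> steep k ->
  exists z : int, `|ev ultimate (item k) - z%:~R| <= 1 / 2 ^+ k.
Proof.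
move=> kk ks; have /asboolP[oB _] := kk; have /asboolP fl := ks.
have kl : (k <= level k)%N by exact: lacunary_scale.
have [Npos _] := fl k; have /andP[_ Nlt] := scaleP Npos.
have [_ /(_ k kk ks erefl) [z ez] _] := svalP (cid (steep_correction (level k)
   (approx (level k) \+ spread_fix (level k) (approx (level k))))).
have {}ez : ev (approx (level k).+1) (item k) = z%:~R by exact: ez.
exists z; rewrite -ez.
apply: le_trans (@ultimate_near (item k) 1 (level k).+1 (fun c => dom_item oB) _) _; last first.
  rewrite exprS invfM mulrA mulr1 mulfV ?pnatr_eq0 //.
  by rewrite !mul1r lef_pV2 ?posrE ?exprn_gt0 // ler_eXn2l ?ltr1n.
move=> j kj; have ij : item k \in settled j by apply: item_settled => //; lia.
have [[k' [kk' ks' kj']]|no] := pselect (exists k', [/\ kept k', steep k' & level k' = j]); last first.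
  rewrite approx_still ?subrr ?normr0 ?divr_ge0 ?exprn_ge0 // => k' kk' ks' kj'.
  by apply: no; exists k'.
have lj : (level k + 2 <= j)%N.
  rewrite -kj' in kj *; case: (kept_steep_level kk ks kk' ks') => // [e|]; last by lia.
  by rewrite e ltnn in kj.
apply: le_trans (approx_step ij (C := 2 ^ ((level k).+1 * (level k).+1)) _) _.
  by move=> c; apply: leq_trans (normB_U1 _ _ _) _; rewrite addn1.
rewrite natrX ler_pdivlMr ?exprn_gt0 // mulrAC ler_pdivrMr ?exprn_gt0 // mul1r -exprD.
rewrite ler_eXn2l ?ltr1n //; nia.
Qed.

Lemma kept_item_small x : x <> Base -> exists C : R, forall k, owner k = x -> kept k ->
  exists z : int, `|ev ultimate (item k) - z%:~R| <= C / 2 ^+ k.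
Proof.
move=> xB; have [lac|nlac] := pselect (lacunary (seq_of x)).
  by exists 1 => k ox kk; apply: steep_item => //; apply/asboolP; rewrite ox.
have [//|[[C fC] _]] := seq_of_tame x.
exists (2 * C.+1%:R) => k ox kk; exists 0; rewrite subr0; apply: spread_item => //.
  by apply/asboolP; rewrite ox.
by rewrite ox.
Qed.

Lemma mem_block n k : (k \in iota (block_start n) (n.+1 * slack n)) = (block_of k == n).
Proof.
rewrite mem_iota -block_startS; apply/idP/eqP => [/block_of_eq //|<-].
exact: block_ofP.
Qed.

(** The levels within the block are pairwise different, and a rejected index has
    a level at distance at most 1 from that of an index kept in an earlier
    block. *)
Lemma steep_dropped i n : D i <> Base -> lacunary (seq_of (D i)) -> (first_level <= n)%N ->
  (forall k, block_of k = n -> owner k = D i) ->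
  (size [seq k <- iota (block_start n) (n.+1 * slack n) | ~~ kept k] <= 3 * slack n)%N.
Proof.
move=> iB lac nl own; set bs := block_start n; set l := [seq k <- _ | ~~ kept k].
have inl k : k \in l -> block_of k = n /\ ~~ kept k.
  by rewrite mem_filter mem_block => /andP[kk /eqP].
have level_mono j k : block_of j = n -> block_of k = n -> (j < k)%N -> (level j + 2 <= level k)%N.
  by move=> jn kn jk; rewrite /level !own //; have [_] := lac k; exact.
pose T := [seq (level j + d).-1 | j <- kept_before bs, d <- iota 0 3].
have : (size (map level l) <= size T)%N.
  apply: uniq_leq_size => [|_ /mapP[k kl ->]].
    rewrite map_inj_in_uniq ?filter_uniq ?iota_uniq // => j k /inl[jn _] /inl[kn _] e.
    by case: (ltngtP j k) => // [/(level_mono _ _ jn kn)|/(level_mono _ _ kn jn)]; lia.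
  have [kn /asboolP kk] := inl k kl; apply: contrapT => /negP kT; apply: kk.
  have ok : owner k = D i by exact: own.
  split; first by rewrite ok.
  have -> : steep k by apply/asboolP; rewrite ok.
  split.
    rewrite /level ok; apply: leq_trans (lacunary_scale _ lac); rewrite (leq_trans nl) //.
    by rewrite -kn; apply: leq_trans (block_start_ge _) _; case/andP: (block_ofP k).
  move=> j; rewrite mem_kept_before => /andP[jk kj] sj.
  have [jn|jn] := eqVneq (block_of j) n; first by left; exact: level_mono.
  have jbs : (j < bs)%N.
    rewrite ltnNge; apply/negP => bsj; case/eqP: jn; apply: block_of_eq.
    by rewrite bsj (ltn_trans jk) // -kn; case/andP: (block_ofP k).
  apply: contrapT => far; case/negP: kT; apply/allpairsP.
  exists (j, (level k).+1 - level j)%N; split => /=; last by lia.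
    by rewrite mem_kept_before jbs.
  by rewrite !inE; lia.
rewrite size_map size_allpairs size_iota mulnC => /leq_trans; apply.
by rewrite leq_mul2l (leq_trans (size_kept_before _)) // leq_addr.
Qed.

(** The terms in the block are linearly independent, and the rejected ones lie in
    the span of the frame, the items kept in earlier blocks and the kept terms of
    the block itself. *)
Lemma spread_dropped i n : D i <> Base -> spreading (seq_of (D i)) -> ~ lacunary (seq_of (D i)) ->
  (i <= n)%N -> (forall k, block_of k = n -> owner k = D i) ->
  (size [seq k <- iota (block_start n) (n.+1 * slack n) | ~~ kept k] <= slack n)%N.
Proof.
move=> iB [_ spr] nlac i_n own; set bs := block_start n; set m := (n.+1 * slack n)%N.
pose f (q : 'I_m) := seq_of (D i) (bs + q)%N.
pose c k := sval (cid (spr k)).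
have cP k : coeff (c k) (seq_of (D i) k) != 0 /\
  forall j, (j < k)%N -> coeff (c k) (seq_of (D i) j) = 0 := svalP (cid (spr k)).
pose w (q : 'I_m) : code -> R := fun c' => 1 *+ (c' == c (bs + q)%N).
pose S := [seq q : 'I_m <- enum 'I_m | kept (bs + q)%N].
pose V := frame bs ++ map item (kept_before bs).
have blk (q : 'I_m) : block_of (bs + q)%N = n.
  by apply/eqP; rewrite -mem_block mem_iota leq_addr ltn_add2l /=.
have blk0 : block_of bs = n.
  by apply: block_of_eq; rewrite leqnn block_startS -[ltnLHS]addn0 ltn_add2l muln_gt0 /slack addnS.
have frameE (q : 'I_m) : frame (bs + q)%N = frame bs by rewrite /frame blk blk0.
have itemE (q : 'I_m) : item (bs + q)%N = f q - << D i >> by rewrite /item own.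
have Dframe : << D i >> \in frame bs.
  by apply/frameP; right; exists i; rewrite ?blk0.
have /= : (m <= size V + size S)%N.
  apply: (@exchange R code m f w).
  - by move=> q; rewrite ev_delta mulr1 intr_eq0; have [] := cP (bs + q)%N.
  - move=> q r rq; rewrite ev_delta mulr1; have [_ ->] := cP (bs + q)%N => //.
    by rewrite ltn_add2l.
  - move=> psi q psiV psiS; have [qS|qS] := boolP (kept (bs + q)%N).
      by apply: psiS; rewrite mem_filter qS mem_enum.
    have psiD : ev psi << D i >> = 0 by apply: psiV; rewrite mem_cat Dframe.
    have -> : f q = item (bs + q)%N + << D i >> by rewrite itemE subrK.
    rewrite raddfD /= psiD addr0; apply: contrapT => /eqP nz.
    case/asboolP: qS; split; first by rewrite own ?blk.
    have -> : steep (bs + q)%N = false by apply/asboolP; rewrite own ?blk.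
    exists psi => // v; rewrite mem_cat frameE => /orP[vV|]; first by apply: psiV; rewrite mem_cat vV.
    case/mapP => j; rewrite mem_kept_before => /andP[jq kj] ->.
    have [jbs|bsj] := ltnP j bs.
      by apply: psiV; rewrite mem_cat map_f ?orbT // mem_kept_before jbs.
    have jm : (j - bs < m)%N by have := ltn_ord q; lia.
    have ej : j = (bs + Ordinal jm)%N by rewrite /= subnKC.
    rewrite ej itemE raddfB /= psiD subr0; apply: psiS.
    by rewrite mem_filter -ej kj mem_enum.
have -> : size S = count kept (iota bs m).
  rewrite size_filter -{2}[bs]addn0 iotaDl count_map -val_enum_ord count_map.
  by apply: eq_count => q.
move=> mVS; rewrite size_filter -(leq_add2r (count kept (iota bs m))).
have -> : (count (fun k => ~~ kept k) (iota bs m) + count kept (iota bs m))%N = m.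
  by rewrite addnC (count_predC kept) size_iota.
apply: leq_trans mVS _; rewrite leq_add2r /V size_cat size_map /frame /= size_map size_iota blk0.
by have := size_kept_before bs; rewrite /slack -/bs; lia.
Qed.

(** Almost every block of the trace of [D i] belongs to [D i], and the selection
    rejects only few members of such a block. *)
Lemma kept_large i : D i <> Base ->
  limit_filter (D i) [set k | owner k = D i /\ kept k].
Proof.
move=> iB; have [n0 own] := owner_eventually iB.
apply: limit_filter_block; exists 3%N, (n0 + i + first_level)%N => n n0n tr.
have {}own k : block_of k = n -> owner k = D i.
  by move=> kn; apply: own; rewrite kn //; lia.
exists [seq k <- iota (block_start n) (n.+1 * slack n) | ~~ kept k] => [|k kn]; last first.
  by rewrite mem_filter mem_block kn eqxx andbT; case kk: (kept k); [right; split; first exact: own|left].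
have [lac|nlac] := pselect (lacunary (seq_of (D i))).
  by apply: steep_dropped lac _ own => //; lia.
have [//|spr] := seq_of_tame (D i).
by apply: leq_trans (spread_dropped iB spr nlac _ own) _; lia.
Qed.

(** The kept items are corrected with an error that tends to 0. *)
Lemma ultimate_limit i : D i <> Base -> forall e, 0 < e ->
  limit_filter (D i) [set k | nearZ e (ev ultimate (seq_of (D i) k) - ultimate (D i))].
Proof.
move=> iB e e0; have [C CP] := kept_item_small iB.
have pU := limit_filter_ultra (D i).
have [m mP] : exists m, forall k, (m <= k)%N -> C / 2 ^+ k < e.
  exists (Num.bound `|C / e|) => k mk; rewrite ltr_pdivrMr ?exprn_gt0 // mulrC -ltr_pdivrMr //.
  apply: le_lt_trans (ler_norm _) _; apply: lt_le_trans (archi_boundP (normr_ge0 _)) _.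
  by rewrite -natrX ler_nat (leq_trans mk) // ltnW // ltn_expl.
apply: filterS2 (kept_large iB) (limit_filter_cofinite (D i) (m := m) (U := [set k | (m <= k)%N]) _) => //.
move=> k [ok kk] /= mk; have [z zP] := CP k ok kk; exists z.
apply: le_lt_trans (mP k mk); move: zP; rewrite /item ok raddfB /=.
by rewrite evU mul1r.
Qed.

Hypothesis D_Base : range D Base.

(** Outside [D] the value at a limit code is forced by the values at its
    subterms.  The case distinction unfolds [seq_of], which makes the recursion
    structural. *)
Fixpoint extend x : R :=
  if `[< range D x >] then ultimate x else
  match x with
  | Base => 0
  | Limit b d c => ultra_limit (Limit b d c) (fun k =>
      if `[< tame (written d c) >]
      then \sum_(i < size (d k)) ((d k)`_i)%:~R * extend (c k i)
      else ((2 ^ (k.*2 * k.*2))%N%:Z)%:~R * ultimate Base)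
  end.

Lemma extend_in x : range D x -> extend x = ultimate x.
Proof. by case: x => [|b d c] Dx /=; rewrite asboolT. Qed.

Lemma extend_out x : ~ range D x -> extend x = ultra_limit x (fun k => ev extend (seq_of x k)).
Proof.
case: x => // b d c nD; rewrite [LHS]/= asboolF //; congr ultra_limit.
apply/funext => k /=; case: asboolP => _; last by rewrite evU extend_in.
by rewrite /written raddf_sum; apply: eq_bigr => i _; rewrite /= evU.
Qed.

Lemma extend_admissible : admissible extend.
Proof.
move=> x xB e e0; have [[i _ ix]|/extend_out ->] := pselect (range D x); last first.
  exact: ultra_limitP.
rewrite -ix in xB *; rewrite extend_in; last by exists i.
have pU := limit_filter_ultra (D i); apply: filterS (ultimate_limit xB e0) => k /=.
by rewrite (eq_ev (psi' := ultimate)) // => c /D_closed /extend_in.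
Qed.

(** The value at [a] lies between 1/4 and 3/4. *)
Lemma extend_separates : ~ nearZ (1 / 4) (ev extend a).
Proof.
rewrite (eq_ev (psi' := ultimate)) => [|c /D_a /extend_in //].
have := ultimate_a; rewrite ler_norml => /andP[h1 h2] [z]; rewrite ltr_norml => /andP[h3 h4].
have z0 : (0 < z)%R by rewrite -(ltr0z R); lra.
have z1 : (z < 1)%R by rewrite -(ltrz1 R); lra.
lia.
Qed.

End Separation.

Fixpoint subterm x (p : seq (nat * nat)) : code :=
  match x, p with
  | Limit b d c, (k, i) :: q => subterm (c k i) q
  | _, _ => x
  end.

Lemma subterm_rcons x p b d c k i :
  subterm x p = Limit b d c -> subterm x (rcons p (k, i)) = c k i.
Proof.
elim: p x => [|[k' i'] p IH] [|b' d' c'] //=; last exact: IH.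
by case=> _ _ ->; case: (c k i).
Qed.

(** The coordinates of [a], together with [Base], are made the immediate
    subterms of an auxiliary code, whose subterms then form a countable set that
    is closed in the sense required by the construction above. *)
Theorem separation (R : realType) (a : vec) : a != 0 ->
  exists Phi : code -> R, admissible Phi /\ ~ nearZ (1 / 4) (ev Phi a).
Proof.
move=> a0; pose y := Limit true (fun=> [::]) (fun _ i => nth Base (dom a) i).
pose D i := subterm y (odflt [::] (unpickle i)).
have DE p : range D (subterm y p) by exists (pickle p) => //; rewrite /D pickleK.
have DB : range D Base.
  by have := DE [:: (0, size (dom a))]; rewrite /= nth_default.
have Da c : c \in dom a -> range D c.
  move=> ca; have := DE [:: (0, index c (dom a))].
  by rewrite /= nth_index //; case: c {ca}.
have Dcl i k c : c \in dom (seq_of (D i) k) -> range D c.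
  move=> /dom_seq_of[->//|[b [d [c' [j [/subterm_rcons e ->]]]]]].
  by rewrite -(e k j); exact: DE.
by exists (extend a D); split; [apply: extend_admissible | apply: extend_separates].
Qed.

(** * The topological group *)

Definition limit_group (R : realType) : Type := {freeg code / int}.

HB.instance Definition _ (R : realType) :=
  Choice.copy (limit_group R) {freeg code / int}.

Section GroupStructure.
Context {R : realType}.
Local Notation G := (limit_group R).
Implicit Types (x y z : vec).

Let mulgA : associative (fun x y : G => (x : vec) + (y : vec) : G).
Proof. exact: addrA. Qed.
Let mul1g : left_id (0 : vec) (fun x y : G => (x : vec) + (y : vec) : G).
Proof. exact: add0r. Qed.
Let mulg1 : right_id (0 : vec) (fun x y : G => (x : vec) + (y : vec) : G).
Proof. exact: addr0. Qed.
Let mulVg : left_inverse (0 : vec) (fun x : G => - (x : vec) : G)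
  (fun x y : G => (x : vec) + (y : vec) : G).
Proof. exact: addNr. Qed.
Let mulgV : right_inverse (0 : vec) (fun x : G => - (x : vec) : G)
  (fun x y : G => (x : vec) + (y : vec) : G).
Proof. exact: addrN. Qed.

HB.instance Definition _ := isGroup.Build G mulgA mul1g mulg1 mulVg mulgV.

Definition char_ball (L : seq (code -> R)) (e : R) (x : vec) : set vec :=
  [set y | forall Phi, Phi \in L -> nearZ e (ev Phi (y - x))].

Definition char_nbhs (x : G) : set_system G :=
  [set U | exists L e, [/\ forall Phi, Phi \in L -> admissible Phi, 0 < e &
     char_ball L e x `<=` U]].

Lemma char_ball_center L e x : 0 < e -> char_ball L e x x.
Proof. by move=> e0 Phi _; rewrite subrr raddf0; exact: nearZ0. Qed.

Lemma char_ball_triangle L e e' x y z :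
  char_ball L e x y -> char_ball L e' y z -> char_ball L (e + e') x z.
Proof.
move=> xy yz Phi PL; have -> : z - x = (y - x) + (z - y) by rewrite [RHS]addrC addrA subrK.
rewrite raddfD; exact: nearZD (xy Phi PL) (yz Phi PL).
Qed.

Lemma char_ballS L L' e e' x : {subset L' <= L} -> e <= e' ->
  char_ball L e x `<=` char_ball L' e' x.
Proof. by move=> LL ee y xy Phi /LL PL; exact: nearZ_le ee (xy Phi PL). Qed.

HB.instance Definition _ := hasNbhs.Build G char_nbhs.

Let char_nbhs_filter (x : G) : ProperFilter (nbhs x).
Proof.
split.
  by move=> [L [e [_ e0 /(_ x)]]]; apply; exact: char_ball_center.
split; first by exists [::], 1.
  move=> U V [L [e [La e0 LU]]] [L' [e' [La' e0' LV]]].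
  exists (L ++ L'), (Num.min e e'); split.
  - by move=> Phi; rewrite mem_cat => /orP[/La|/La'].
  - by rewrite lt_min e0.
  - move=> y xy; split; [apply: LU|apply: LV]; apply: char_ballS xy.
    + by move=> Phi PL; rewrite mem_cat PL.
    + by rewrite ge_min lexx.
    + by move=> Phi PL; rewrite mem_cat PL orbT.
    + by rewrite ge_min lexx orbT.
by move=> U V UV [L [e [La e0 LU]]]; exists L, e; split=> // y /LU /UV.
Qed.

Let char_nbhs_singleton (x : G) (U : set G) : nbhs x U -> U x.
Proof. by move=> [L [e [_ e0 /(_ x)]]]; apply; exact: char_ball_center. Qed.

Let char_nbhs_nbhs (x : G) (U : set G) : nbhs x U -> nbhs x (nbhs^~ U).
Proof.
move=> [L [e [La e0 LU]]]; have e20 : 0 < e / 2 by lra.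
exists L, (e / 2); split=> // y xy; exists L, (e / 2); split=> // z yz.
by apply: LU; rewrite (splitr e); exact: char_ball_triangle xy yz.
Qed.

HB.instance Definition _ := Nbhs_isNbhsTopological.Build G
  char_nbhs_filter char_nbhs_singleton char_nbhs_nbhs.

Let mulg_continuous : continuous (fun x : G * G => (x.1 * x.2)%g).
Proof.
move=> [x y] U [L [e [La e0 LU]]]; have e20 : 0 < e / 2 by lra.
exists (char_ball L (e / 2) x, char_ball L (e / 2) y) => [|[u v] [/= xu yv]].
  by split; exists L, (e / 2); split.
apply: LU => Phi PL; have := nearZD (xu Phi PL) (yv Phi PL).
rewrite -splitr -raddfD; congr (nearZ _ (ev _ _)).
by rewrite opprD addrACA.
Qed.

Let invg_continuous : continuous (fun x : G => (x^-1)%g).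
Proof.
move=> x U [L [e [La e0 LU]]]; exists L, e; split=> // y xy.
apply: LU => Phi PL; have := nearZN (xy Phi PL).
by rewrite -raddfN opprD.
Qed.

HB.instance Definition _ := isTopologicalGroup.Build G mulg_continuous invg_continuous.

End GroupStructure.

(** * Properties of the group *)

Section GroupProperties.
Context {R : realType}.
Local Notation G := (limit_group R).
Implicit Types (L : seq (code -> R)).

Lemma nbhs_char_ball L e (x : G) : (forall Phi, Phi \in L -> admissible Phi) ->
  0 < e -> nbhs x (char_ball L e x).
Proof. by move=> La e0; exists L, e; split. Qed.

Lemma hausdorff_limit_group (x y : G) : x <> y ->
  exists U V, [/\ nbhs x U, nbhs y V & forall z, U z -> V z -> False].
Proof.
move=> /eqP; rewrite -subr_eq0 => /(separation R) [Phi [Pa far]].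
have Pl Psi : Psi \in [:: Phi] -> admissible Psi by rewrite inE => /eqP ->.
exists (char_ball [:: Phi] (1 / 8) x), (char_ball [:: Phi] (1 / 8) y).
split=> [||z xz yz]; [by apply: nbhs_char_ball => //; lra..|].
apply: far; have -> : x - y = (z - y) - (z - x) :> vec.
  by rewrite opprB [RHS]addrC addrA subrK.
rewrite raddfB; apply: nearZ_le (nearZD (yz Phi (mem_head _ _)) (nearZN (xz Phi (mem_head _ _)))).
by lra.
Qed.

Lemma limit_filter_seq (T : eqType) x (L : seq T) (P : T -> nat -> Prop) :
  (forall t, t \in L -> limit_filter x (P t)) ->
  limit_filter x [set k | forall t, t \in L -> P t k].
Proof.
have pU := limit_filter_ultra x.
elim: L => [|t L IH] LP; first exact: (limit_filter_cofinite x (m := 0%N)).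
have Pt := LP t (mem_head t L).
have PL : limit_filter x [set k | forall t', t' \in L -> P t' k].
  by apply: IH => t' t'L; apply: LP; rewrite inE t'L orbT.
apply: filterS2 Pt PL => k tk Lk t'; rewrite inE => /predU1P[->//|]; exact: Lk.
Qed.

(** Admissibility is exactly this convergence, tested on one character at a
    time; a basic neighbourhood involves finitely many characters. *)
Lemma code_limit x (U : set G) : x <> Base -> nbhs (<< x >> : G) U ->
  limit_filter x [set k | U (seq_of x k)].
Proof.
move=> xB [L [e [La e0 LU]]]; have pU := limit_filter_ultra x.
have := limit_filter_seq (fun Phi PL => La Phi PL x xB e e0); apply: filterS => k kL.
by apply: LU => Phi PL; rewrite raddfB /= evU mul1r; exact: kL.
Qed.

Lemma inj_limit_filter x (s : nat -> nat) m : injective s ->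
  limit_filter x [set k | (m <= s k)%N].
Proof.
move=> s_inj; suff [N NP] : exists N, forall k, (N <= k)%N -> (m <= s k)%N.
  exact: limit_filter_cofinite NP.
elim: m => [|m [N NP]]; first by exists 0%N.
have [[k0 k0m]|no] := pselect (exists k, s k = m); last first.
  exists N => k /NP; rewrite leq_eqVlt => /predU1P[e|//]; by case: no; exists k.
exists (maxn N k0.+1) => k; rewrite geq_max => /andP[/NP mk lt].
rewrite ltn_neqAle mk andbT; apply/eqP => e.
by move: lt; rewrite (s_inj k k0) ?ltnn // k0m.
Qed.

(** A tame subsequence is the sequence of two different codes, which differ
    only in their Boolean tag, and each of them is a limit of it along an
    ultrafilter. *)
Lemma two_clusters (u : nat -> G) : (forall l : seq G, exists k, u k \notin l) ->
  exists s x y, [/\ injective (u \o s), x <> y,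
    forall U, nbhs (<< x >> : G) U -> limit_filter x [set k | U (u (s k))] &
    forall U, nbhs (<< y >> : G) U -> limit_filter y [set k | U (u (s k))]].
Proof.
move=> /(@tame_subsequence u) [s st]; have [x [y [xB yB xy fx fy]]] := tame_seq_of st.
exists s, x, y; split=> // [|U /(code_limit xB)|U /(code_limit yB)].
- exact: tame_inj st.
- by rewrite fx.
- by rewrite fy.
Qed.

Lemma freegU_inj x y : << x >> = << y >> :> vec -> x = y.
Proof.
move=> /(congr1 (coeff y)) /eqP; rewrite !coeffU eqxx !mul1r.
by case: (x =P y).
Qed.

Lemma inj_infinite_range (T : eqType) (u : nat -> T) : injective u ->
  forall l : seq T, exists k, u k \notin l.
Proof.
move=> u_inj l; apply: contrapT => no.
have : (size (map u (iota 0 (size l).+1)) <= size l)%N.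
  apply: uniq_leq_size; first by rewrite map_inj_uniq ?iota_uniq.
  by move=> _ /mapP[k _ ->]; apply: contrapT => /negP kl; apply: no; exists k.
by rewrite size_map size_iota ltnn.
Qed.

Lemma infinite_avoid (T : eqType) (A : set T) : infinite_set A ->
  forall l : seq T, exists x, A x /\ x \notin l.
Proof.
move=> Ainf l; apply: contrapT => no; apply: Ainf.
apply: (@sub_finite_set _ _ [set` l]) => [x Ax|]; last exact: finite_seq.
by apply: contrapT => /negP xl; apply: no; exists x.
Qed.

Lemma infinite_limit_group : infinite_set [set: G].
Proof.
move=> /finite_seqP[l lT]; have [k /negP] := inj_infinite_range (tame_inj base_powers_tame) l.
by apply; have : [set: G] (base_powers k) by []; rewrite lT.
Qed.

(** Without a finite subcover there is a sequence whose n-th term lies in none of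
    the first n sets of the cover; the set that contains a cluster point of it
    would contain arbitrarily late terms. *)
Lemma countably_compact_limit_group : countably_compact [set: G].
Proof.
move=> I D f /countable_injP[g g_inj] f_open coverT; apply: contrapT => nofin.
have finD n : exists l : seq I, (forall i, i \in l -> D i) /\
    (forall i, D i -> (g i <= n)%N -> i \in l).
  elim: n => [|n [l [lD ln]]].
    have [[i [Di gi]]|no] := pselect (exists i, D i /\ g i = 0%N).
      exists [:: i]; split=> [j|j Dj]; first by rewrite inE => /eqP ->.
      rewrite leqn0 inE => /eqP gj; apply/eqP/g_inj; rewrite ?inE //.
      by rewrite gi gj.
    exists [::]; split=> // j Dj; rewrite leqn0 => /eqP gj; case: no; by exists j.
  have [[i [Di gi]]|no] := pselect (exists i, D i /\ g i = n.+1).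
    exists (i :: l); split=> [j|j Dj]; first by rewrite inE => /orP[/eqP ->//|/lD].
    rewrite leq_eqVlt inE => /orP[/eqP gj|/ln -> //]; last by rewrite orbT.
    by apply/orP; left; apply/eqP/g_inj; rewrite ?inE // gi gj.
  exists l; split=> // j Dj; rewrite leq_eqVlt => /orP[/eqP gj|/ln ->//].
  by case: no; exists j.
have missed n : exists x : G, forall i, D i -> (g i <= n)%N -> ~ f i x.
  have [l [lD ln]] := finD n; apply: contrapT => no; apply: nofin.
  exists [fset i in l]%fset => [i|x _]; first by rewrite !inE => /lD.
  apply: contrapT => nx; apply: no; exists x => i Di gi fx; apply: nx.
  by exists i => //=; rewrite inE ln.
pose u n : G := sval (cid (missed n)).
have uP n i : D i -> (g i <= n)%N -> ~ f i (u n) := svalP (cid (missed n)) i.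
have [|s [x [y [us_inj _ ux _]]]] := two_clusters (u := u).
  move=> l; apply: contrapT => no.
  have ul k : u k \in l by apply: contrapT => /negP kl; apply: no; exists k.
  have [m mP] : exists m, forall z, z \in l -> exists i, [/\ D i, f i z & (g i <= m)%N].
    elim: (l : seq G) => [|z l' [m mP]]; first by exists 0%N.
    have [i Di fiz] := coverT z Logic.I; exists (maxn m (g i)) => z'.
    rewrite inE => /orP[/eqP ->|/mP[j [Dj fj gj]]].
      by exists i; split=> //; exact: leq_maxr.
    by exists j; split=> //; rewrite (leq_trans gj) // leq_maxl.
  by have [i [Di fi gi]] := mP _ (ul m); exact: uP Di gi fi.
have [i Di fix_] := coverT (<< x >> : G) Logic.I.
have s_inj : injective s by move=> j k e; apply: us_inj; rewrite /= e.
have pU := limit_filter_ultra x.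
have [k [fk gk]] : exists k, f i (u (s k)) /\ (g i <= s k)%N.
  apply: (@filter_ex _ (limit_filter x)); apply: filterI (inj_limit_filter x (g i) s_inj).
  by apply: ux; apply: open_nbhs_nbhs; split=> //; exact: f_open.
exact: uP Di gk fk.
Qed.

(** A convergent sequence with finitely many values is eventually constant as
    points can be separated; one with infinitely many values has two cluster
    points, both equal to its limit. *)
Lemma no_convergent_limit_group : no_nontrivial_convergent_seq G.
Proof.
move=> u l ul; have [fin|] := pselect (exists s : seq G, forall k, u k \in s); last first.
  move=> inf; have [|s [x [y [us_inj xy ux uy]]]] := two_clusters (u := u).
    move=> s; apply: contrapT => no; apply: inf; exists s => k.
    by apply: contrapT => /negP kl; apply: no; exists k.
  have s_inj : injective s by move=> j k e; apply: us_inj; rewrite /= e.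
  suff lim z : (forall U, nbhs (<< z >> : G) U -> limit_filter z [set k | U (u (s k))]) ->
      << z >> = l :> G.
    by case: xy; apply: freegU_inj; rewrite (lim x ux) (lim y uy).
  move=> zP; apply: contrapT => /hausdorff_limit_group[U [V [zU lV UV]]].
  have [m _ mP] := ul _ lV; have pU := limit_filter_ultra z.
  have [k [Uk mk]] := @filter_ex _ (limit_filter z) _ _ (filterI (zP _ zU) (inj_limit_filter z m s_inj)).
  exact: UV Uk (mP _ mk).
have [s us] := fin; exists l.
have : nbhs l [set z : G | z \in s -> z = l].
  elim: (s : seq G) => [|z t IH]; first by apply: filterS filterT => z _.
  have [->|/nesym /hausdorff_limit_group[U [V [lU zV UV]]]] := pselect (z = l).
    apply: filterS IH => z' h /=; rewrite inE => /orP[/eqP //|/h//].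
  apply: filterS2 IH lU => z' h Uz' /=; rewrite inE => /orP[/eqP e|/h//].
  by case: (UV z') => //; rewrite e; exact: nbhs_singleton zV.
by move=> /ul h; apply: (@filterS _ eventually _ _ _ _ h) => k hk; exact: hk (us k).
Qed.

(** A cluster point of an injective sequence in [S] that differs from 1 belongs to
    [S] and is not isolated in it; as there are two cluster points, one of them
    differs from 1. *)
Lemma no_infinite_suitable_limit_group :
  ~ (exists S : set G, infinite_set S /\ suitable_set S).
Proof.
move=> [S [Sinf [Sdis Scl _]]].
have [u uP] := select (fun l => infinite_avoid Sinf l).
have uS k : S (u k) by have [] := uP k.
have u_neq j k : (j < k)%N -> u j <> u k.
  by move=> jk e; have [_ /negP] := uP k; rewrite -e; apply; rewrite map_f // mem_iota.
have u_inj : injective u.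
  by move=> j k e; case: (ltngtP j k) => // [/u_neq|/u_neq/nesym]; move/(_ e).
have [s [x [y [us_inj xy ux uy]]]] := two_clusters (inj_infinite_range u_inj).
suff cl z : (forall U, nbhs (<< z >> : G) U -> limit_filter z [set k | U (u (s k))]) ->
    << z >> = 0 :> vec.
  by case: xy; apply: freegU_inj; rewrite (cl x ux) (cl y uy).
move=> zP; have pU := limit_filter_ultra z.
have [Sz|//] : (S `|` [set 1%g]) (<< z >> : G).
  apply: Scl => U /zP zU; have [k Uk] := @filter_ex _ (limit_filter z) _ _ zU.
  by exists (u (s k)); split=> //; left.
have /= [W Wo We] := Sdis [set t | set_val t = << z >>].
have SW t : W t -> S t -> t = << z >>.
  move=> Wt St; have : (set_val @^-1` W) (SigSub (mem_set St) : set_type S) by [].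
  by rewrite We.
have Wz : W << z >>.
  suff : (set_val @^-1` W) (SigSub (mem_set Sz) : set_type S) by [].
  by rewrite We.
have /zP zW : nbhs (<< z >> : G) W by apply: open_nbhs_nbhs.
have := filterI zW (limit_filter_cofinite z (m := 1) (U := [set k | (1 <= k)%N]) (fun _ => id)).
have E k : W (u (s k)) -> u (s k) = << z >> by move=> /SW; apply.
have [k0 W0] := @filter_ex _ (limit_filter z) _ _ zW.
have [k [Wk kk0]] := @filter_ex _ (limit_filter z) _ _
  (filterI zW (limit_filter_cofinite z (m := k0.+1) (U := [set k | (k0 < k)%N]) (fun _ => id))).
have ek : k = k0 by apply: us_inj; exact: etrans (E k Wk) (esym (E k0 W0)).
by move: kk0; rewrite /= ek ltnn.
Qed.

Lemma base_multiple (n : int) :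
  generated_subgroup [set (<< Base >> : G)] (<< n *g Base >> : G).
Proof.
move=> H [[H1 HD] /(_ _ erefl) /mem_set Hg].
have HM := group_closedM (conj H1 HD); have HV := group_closedV (conj H1 HD).
have Hn m : (<< m%:Z *g Base >> : G) \in H.
  elim: m => [|m IH]; first by rewrite freegU0; exact: H1.
  by rewrite intS -freegUD; exact: HM.
apply: set_mem; case: n => m //; rewrite NegzE -freegUN; exact: HV (Hn m.+1).
Qed.

(** The vectors approximated by multiples of [Base] form a subgroup.  By induction
    it contains every code, since the terms of the sequence of a code lie in it. *)
Lemma monothetic_limit_group : monothetic G.
Proof.
exists (<< Base >> : G).
pose near_base (a : vec) := forall L e, (forall Phi, Phi \in L -> admissible Phi) ->
  0 < e -> exists n : int, char_ball (R := R) L e a << n *g Base >>.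
have near0 : near_base 0.
  by move=> L e La e0; exists 0; rewrite freegU0; exact: char_ball_center.
have nearD a b : near_base a -> near_base b -> near_base (a + b).
  move=> na nb L e La e0; have e20 : 0 < e / 2 by lra.
  have [n an] := na L _ La e20; have [m bm] := nb L _ La e20.
  exists (n + m) => Phi PL; rewrite -freegUD opprD addrACA raddfD (splitr e).
  exact: nearZD (an Phi PL) (bm Phi PL).
have nearN a : near_base a -> near_base (- a).
  move=> na L e La e0; have [n an] := na L _ La e0; exists (- n) => Phi PL.
  by rewrite -freegUN -opprD raddfN; exact/nearZN/an.
have nearU c z : near_base << c >> -> near_base << z *g c >>.
  move=> nc; have nn m : near_base << m%:Z *g c >>.
    by elim: m => [|m IH]; [rewrite freegU0 | rewrite intS -freegUD; exact: nearD].
  by case: z => m //; rewrite NegzE -freegUN; exact: nearN.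
have near_code x : near_base << x >>.
  elim: x => [|b d c IH] L e La e0; first by exists 1; exact: char_ball_center.
  set x := Limit b d c; have pU := limit_filter_ultra x.
  have e20 : 0 < e / 2 by lra.
  have [k xk] := @filter_ex _ (limit_filter x) _ _
    (@code_limit x _ (fun h => ltac:(discriminate h)) (nbhs_char_ball (<< x >> : G) La e20)).
  have [n kn] : exists n : int, char_ball L (e / 2) (seq_of x k) << n *g Base >>.
    suff : near_base (seq_of x k) by exact.
    rewrite /x /=; case: asboolP => _; last first.
      by move=> L' e' _ e0'; eexists; exact: char_ball_center.
    rewrite /written; apply: (big_ind near_base) => // i _; exact: nearU.
  by exists n; rewrite (splitr e); exact: char_ball_triangle xk kn.
have near_all a : near_base a.
  rewrite -[a]freeg_sumE; apply: (big_ind near_base) => // c _; exact: nearU.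
move=> O [a Oa] oO; have [L [e [La e0 LO]]] : nbhs a O by apply: open_nbhs_nbhs.
have [n an] := near_all a L e La e0; exists (<< n *g Base >> : G); split.
  exact: LO.
exact: base_multiple.
Qed.

End GroupProperties.

Theorem proposition10p5 :
  exists G : topologicalGroupType,
    [/\ infinite_set [set: G], monothetic G, countably_compact [set: G],
        no_nontrivial_convergent_seq G &
        ~ (exists S : set G, infinite_set S /\ suitable_set S)].
Proof.
exists (limit_group Rdefinitions.R); split.
- exact: infinite_limit_group.
- exact: monothetic_limit_group.
- exact: countably_compact_limit_group.
- exact: no_convergent_limit_group.
- exact: no_infinite_suitable_limit_group.
Qed.
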